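(* Let $(S,+,\circ)$ be a dual weak brace. Then a normal subsemigroup $I$ of $(S,+)$ is an ideal of $S$ if and only if $S\cdot I\subseteq I$ and $I\cdot S\subseteq I$.
   Context: A dual weak brace is a triple $(S,+,\circ)$ such that $(S,+)$ is an inverse semigroup, $(S,\circ)$ is a Clifford semigroup (inverse semigroup with central idempotents), and $a\circ(b+c)=a\circ b-a+a\circ c$, $a\circ a^-=-a+a$ for all $a,b,c$, where $-a$, $a^-$ are the inverses of $a$ in $(S,+)$, $(S,\circ)$; then $(S,+)$ is also Clifford and the idempotents of both operations coincide, their set being $\mathrm{E}(S)$. Put $\lambda_a(b)=-a+a\circ b$ and $a\cdot b=-a+a\circ b-b$. For subsets $X,Z\subseteq S$, $X\cdot Z$ denotes the inverse subsemigroup of $(S,+)$ generated by all $x\cdot z$, $x\in X$, $z\in Z$. A normal subsemigroup of a Clifford semigroup $T$ is a subset $I$ containing all idempotents of $T$, closed under products and inverses, with $a^{-1}Ia\subseteq I$ for all $a\in T$. An ideal of $S$ is a subset $I$ that is a normal subsemigroup of both $(S,+)$ and $(S,\circ)$ and satisfies $\lambda_a(I)\subseteq I$ for all $a\in S$. *)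

(* Defs.v *)
From mathcomp Require Import all_boot.
From mathcomp Require Import classical_sets.

Set Implicit Arguments.
Unset Strict Implicit.
Unset Printing Implicit Defensive.

Local Open Scope classical_set_scope.

Section Semigroups.
Variables (T : Type) (op : T -> T -> T) (inv : T -> T).

Definition semigroup_inverse (a b : T) : Prop :=
  op (op a b) a = a /\ op (op b a) b = b.

Definition idempotents : set T := [set e | op e e = e].

(* Every element has exactly one inverse, and [inv] returns it. *)
Definition inverse_semigroup : Prop :=
  associative op /\ forall a b, semigroup_inverse a b <-> b = inv a.

Definition clifford_semigroup : Prop :=
  inverse_semigroup /\ forall e a, idempotents e -> op e a = op a e.

Definition inverse_subsemigroup (I : set T) : Prop :=
  (forall a b, I a -> I b -> I (op a b)) /\ (forall a, I a -> I (inv a)).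

Definition normal_subsemigroup (I : set T) : Prop :=
  [/\ idempotents `<=` I, inverse_subsemigroup I &
      forall a x, I x -> I (op (op (inv a) x) a)].

End Semigroups.

Declare Scope brace_scope.
Delimit Scope brace_scope with brace.

Record dualWeakBrace := DualWeakBrace {
  carrier :> Type;
  badd : carrier -> carrier -> carrier;
  bopp : carrier -> carrier;
  bcirc : carrier -> carrier -> carrier;
  binv : carrier -> carrier;
  badd_inverse_semigroup : inverse_semigroup badd bopp;
  bcirc_clifford_semigroup : clifford_semigroup bcirc binv;
  bcircDr : forall a b c,
    bcirc a (badd b c) = badd (badd (bcirc a b) (bopp a)) (bcirc a c);
  bcircV : forall a, bcirc a (binv a) = badd (bopp a) a
}.

Notation "a + b" := (badd a b) : brace_scope.
Notation "- a" := (bopp a) : brace_scope.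
Notation "a - b" := (badd a (bopp b)) : brace_scope.
Notation "a \circ b" := (bcirc a b)
  (at level 40, left associativity) : brace_scope.
Local Open Scope brace_scope.

Section Ideals.
Variable S : dualWeakBrace.

Definition blambda (a b : S) : S := - a + a \circ b.

Definition bdot (a b : S) : S := - a + a \circ b - b.

Definition bdot_set (X Z : set S) : set S :=
  smallest (inverse_subsemigroup (@badd S) (@bopp S))
    [set bdot x z | x in X & z in Z].

Definition ideal (I : set S) : Prop :=
  [/\ normal_subsemigroup (@badd S) (@bopp S) I,
      normal_subsemigroup (@bcirc S) (@binv S) I &
      forall a x, I x -> I (blambda a x)].

End Ideals.

(* Main.v *)
From mathcomp Require Import all_boot.
Require Import Defs.
From mathcomp Require Import classical_sets.

Set Implicit Arguments.
Unset Strict Implicit.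

Local Open Scope classical_set_scope.

(** The additive semigroup is itself Clifford, with the same idempotents as
    [(S, \circ)], and [e \circ b = e + b] for every idempotent [e].  Hence
    every element absorbs its own idempotent on either side, for both
    operations, and the argument for skew braces applies up to idempotents,
    all of which lie in [I]: [blambda a x = bdot a x + x] and
    [x \circ a = y + a] with [y = x + bdot x a], so that the conjugate of [x]
    by [a] in [(S, \circ)] is, up to an idempotent, the conjugate of
    [blambda a^-1 y] in [(S, +)]. *)

(** * Inverse semigroups and the Clifford condition *)

Section InverseSemigroup.
Variables (T : Type) (op : T -> T -> T) (inv : T -> T).
Hypothesis opI : inverse_semigroup op inv.
Local Notation "x * y" := (op x y).
Local Notation "x ^-1" := (inv x).

Lemma semigroup_opA : associative op. Proof. by case: opI. Qed.
Local Notation A := semigroup_opA.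

Lemma inv_unique a b : a * b * a = a -> b * a * b = b -> b = a^-1.
Proof. by move=> h1 h2; case: opI => _ /(_ a b) [h _]; apply: h. Qed.

Lemma op_opVop a : a * a^-1 * a = a.
Proof. by case: opI => _ /(_ a a^-1) [_ /(_ erefl) []]. Qed.

Lemma op_Vop_opV a : a^-1 * a * a^-1 = a^-1.
Proof. by case: opI => _ /(_ a a^-1) [_ /(_ erefl) []]. Qed.

Lemma semigroup_invK a : a^-1^-1 = a.
Proof. by symmetry; apply: inv_unique; rewrite (op_opVop, op_Vop_opV). Qed.

Lemma inv_idem e : e * e = e -> e^-1 = e.
Proof. by move=> he; symmetry; apply: inv_unique; rewrite !he. Qed.

Lemma idem_op_inv a : (a * a^-1) * (a * a^-1) = a * a^-1.
Proof. by rewrite A op_opVop. Qed.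

Lemma idem_inv_op a : (a^-1 * a) * (a^-1 * a) = a^-1 * a.
Proof. by rewrite A op_Vop_opV. Qed.

(* The inverse [b] of [e * f] equals [f * b * e], hence is idempotent and its
   own inverse. *)
Lemma idem_op e f : e * e = e -> f * f = f -> (e * f) * (e * f) = e * f.
Proof.
move=> he hf; set b := (e * f)^-1.
have h1 : e * f * b * (e * f) = e * f by apply: op_opVop.
have h2 : b * (e * f) * b = b by apply: op_Vop_opV.
have hb : f * b * e = b.
  apply: inv_unique.
    by rewrite !A -(A e f f) hf -(A _ e e) he -A.
  rewrite !A -(A _ e e) he -(A _ f f) hf.
  by rewrite -{3}h2 !A.
have hbb : b * b = b.
  by rewrite -{1 2}hb !A -(A _ e f) -(A f b) -(A f) h2.
by rewrite -(semigroup_invK (e * f)) -/b inv_idem.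
Qed.

(** Both products are idempotent, so [e * f] is its own inverse; [f * e] is an inverse of it too,
    and inverses are unique. *)
Lemma idem_opC e f : e * e = e -> f * f = f -> e * f = f * e.
Proof.
move=> he hf.
have hef := idem_op he hf; have hfe := idem_op hf he.
rewrite -{1}(inv_idem hef); symmetry; apply: inv_unique.
  by rewrite !A -(A e f f) hf -(A _ e e) he -A.
by rewrite !A -(A f e e) he -(A _ f f) hf -A.
Qed.

Lemma semigroup_invM a b : (a * b)^-1 = b^-1 * a^-1.
Proof.
have hC := idem_opC (idem_op_inv b) (idem_inv_op a).
symmetry; apply: inv_unique.
  rewrite !A -(A a b) -(A _ a^-1 a) -(A a) hC.
  by rewrite !A op_opVop -!A (A b) op_opVop.
rewrite !A -(A _ a^-1 a) -(A _ b b^-1) -(A b^-1) -hC.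
by rewrite !A op_Vop_opV -!A (A a^-1) op_Vop_opV.
Qed.

(** The hypothesis at [e * a] gives [e * (a * a^-1) = a^-1 * e * a]; multiplying by [a] on the left
    turns the two sides into [a * e] and [e * a]. *)
Lemma clifford_of_opV : (forall a, a * a^-1 = a^-1 * a) ->
  forall e a, e * e = e -> e * a = a * e.
Proof.
move=> hC e a he.
have h : e * (a * a^-1) = a^-1 * e * a.
  have := hC (e * a).
  rewrite semigroup_invM (inv_idem he) !A -(A _ e e) he -(A e a) => <-.
  by rewrite -[RHS]A -(idem_opC he (idem_op_inv a)) [RHS]A he.
have := congr1 (op a) h.
rewrite (idem_opC he (idem_op_inv a)) {1}hC !A op_opVop => ->.
by rewrite -(idem_opC he (idem_op_inv a)) -!A (A a) op_opVop.
Qed.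

(** Centrality makes each of the idempotents [a * a^-1] and [a^-1 * a] absorb the other. *)
Lemma opV_of_clifford : (forall e a, e * e = e -> e * a = a * e) ->
  forall a, a * a^-1 = a^-1 * a.
Proof.
move=> hC a.
have h1 : a * a^-1 = (a^-1 * a) * (a * a^-1).
  by rewrite A (hC _ a (idem_inv_op a)) A op_opVop.
have h2 : a^-1 * a = (a * a^-1) * (a^-1 * a).
  by rewrite A (hC _ a^-1 (idem_op_inv a)) A op_Vop_opV.
by rewrite h1 [RHS]h2 (hC _ _ (idem_inv_op a)).
Qed.

End InverseSemigroup.

Section DualWeakBrace.
Variable S : dualWeakBrace.
Local Open Scope brace_scope.
Implicit Types a b c e f g x y : S.
Local Notation "a ^-1" := (binv a).

Let addI := badd_inverse_semigroup S.
Let circI : inverse_semigroup (@bcirc S) (@binv S).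
Proof. by case: (bcirc_clifford_semigroup S). Qed.
Local Notation addA := (semigroup_opA addI).
Local Notation circA := (semigroup_opA circI).

Lemma circ_idemC e a : e \circ e = e -> e \circ a = a \circ e.
Proof. by case: (bcirc_clifford_semigroup S) => _; apply. Qed.

Lemma circVC a : a \circ a^-1 = a^-1 \circ a.
Proof. exact: (opV_of_clifford circI circ_idemC). Qed.

(** * Idempotents of the two operations *)

Lemma add_idem_circ e : e + e = e -> e \circ e = e.
Proof.
move=> he; have h : e \circ e^-1 = e by rewrite bcircV (inv_idem addI he).
by rewrite -h (idem_op_inv circI).
Qed.

Lemma circ_idem_add e : e \circ e = e -> e + e = e.
Proof.
move=> he.
have h : - e + e = e by rewrite -bcircV (inv_idem circI he).
by rewrite -h (idem_inv_op addI).
Qed.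

Lemma idem_addC e f : e + e = e -> f + f = f -> e + f = f + e.
Proof. exact: (idem_opC addI). Qed.

Lemma idem_circ_add e f : e + e = e -> f + f = f ->
  e \circ f + e \circ f = e \circ f.
Proof.
by move=> he hf; apply/circ_idem_add/(idem_op circI); apply: add_idem_circ.
Qed.

Lemma idem_circ_le e f : e + e = e -> f + f = f -> e + e \circ f = e \circ f.
Proof.
move=> he hf; have hg := idem_circ_add he hf.
have := bcircDr e f f; rewrite hf (inv_idem addI he).
by rewrite -(idem_addC he hg) -addA hg.
Qed.

Lemma idem_circ e f : e + e = e -> f + f = f -> e \circ f = e + f.
Proof.
move=> he hf; have hef := idem_op addI he hf; have hg := idem_circ_add he hf.
have hC : e \circ f = f \circ e by apply/circ_idemC/add_idem_circ.
have hfg : f + e \circ f = e \circ f by rewrite hC idem_circ_le.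
have h1 : (e + f) \circ e = e \circ f.
  rewrite (circ_idemC e (add_idem_circ hef)) bcircDr (inv_idem addI he).
  by rewrite (add_idem_circ he) he idem_circ_le.
have h2 : (e + f) \circ f = e \circ f.
  rewrite (circ_idemC f (add_idem_circ hef)) bcircDr (inv_idem addI hf).
  by rewrite (add_idem_circ hf) -hC -addA hf -(idem_addC hf hg).
(* The left side is the square of the idempotent [e + f]; by [h1] and [h2] the right side collapses
   to [e \circ f]. *)
have := bcircDr (e + f) e f.
rewrite (add_idem_circ hef) h1 h2 (inv_idem addI hef) => ->.
by rewrite -(idem_addC hef hg) -addA hg -addA hfg idem_circ_le.
Qed.

(** * Multiplication by an idempotent, and the Clifford property of addition *)

Lemma circ_addr_idem e b : e + e = e -> e \circ b + e = e \circ b.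
Proof.
move=> he; set c := e \circ b.
have hc : e \circ c = c by rewrite /c circA (add_idem_circ he).
have hg := idem_inv_op addI c.
(* Here [c + (- c + c)] is [c], which [e] fixes, while the right side reduces to [c + e]. *)
have := bcircDr e c (- c + c).
rewrite addA (op_opVop addI) hc (inv_idem addI he) (idem_circ he hg).
rewrite -addA (addA e) he (idem_addC he hg) !addA (op_opVop addI).
by move=> <-.
Qed.

Lemma idem_circDr e b c : e + e = e -> e \circ (b + c) = e \circ b + e \circ c.
Proof. by move=> he; rewrite bcircDr (inv_idem addI he) circ_addr_idem. Qed.

Lemma idem_circN e b : e + e = e -> e \circ (- b) = - (e \circ b).
Proof.
move=> he; apply: (inv_unique addI); rewrite -!idem_circDr //.
  by rewrite (op_opVop addI).
by rewrite (op_Vop_opV addI).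
Qed.

Lemma circ_addl_idem e b : e + e = e -> e + e \circ b = e \circ b.
Proof.
move=> he; have := circ_addr_idem (- b) he; rewrite idem_circN //.
move/(congr1 (@bopp S)).
by rewrite (semigroup_invM addI) !(semigroup_invK addI) (inv_idem addI he).
Qed.

(** The idempotent [- a + a] is [a \circ a^-1], which fixes [a] under [\circ], so left absorption
    applies to it. *)
Lemma addNl_addl a : - a + a + a = a.
Proof.
have h : (- a + a) \circ a = a by rewrite -bcircV (op_opVop circI).
by have := circ_addl_idem a (idem_inv_op addI a); rewrite h.
Qed.

Lemma addNC a : a - a = - a + a.
Proof.
(* Taken at [a] and at [- a], this makes the two commuting idempotents absorb each other. *)
have h b : (- b + b) + (b - b) = b - b by rewrite addA addNl_addl.
rewrite -h (idem_addC (idem_inv_op addI a) (idem_op_inv addI a)).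
by have := h (- a); rewrite !(semigroup_invK addI).
Qed.

Lemma add_idemC e a : e + e = e -> e + a = a + e.
Proof. exact: (clifford_of_opV addI addNC). Qed.

Lemma circV a : a \circ a^-1 = a - a.
Proof. by rewrite bcircV addNC. Qed.

Lemma circ_idem e b : e + e = e -> e \circ b = e + b.
Proof.
move=> he; set g := b - b.
have hg : g + g = g := idem_op_inv addI b.
have hk : e + g + (e + g) = e + g := idem_op addI he hg.
have hb : g \circ b = b by rewrite /g -circV (op_opVop circI).
(* The idempotent [e + g] belongs to [e + b], hence fixes it; distributing [(e + g) \circ (e + b)]
   then leaves only [e \circ b]. *)
have hkb : (e + g) \circ b = e \circ b by rewrite -idem_circ // -circA hb.
have hke : (e + g) \circ (e + b) = e + b.
  have -> : e + g = e + b - (e + b).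
    rewrite (semigroup_invM addI) (inv_idem addI he) addA -(addA e) -/g.
    by rewrite -addA -(add_idemC g he) addA he.
  by rewrite -circV (op_opVop circI).
have hkk : (e + g) \circ e = e + g.
  by rewrite idem_circ // -addA -(add_idemC g he) addA he.
by rewrite -hke idem_circDr // hkk hkb -hkb circ_addl_idem.
Qed.

(** * Products and inverses through [blambda] and [bdot] *)

Lemma circ_addNr a x : a \circ x - x + x = a \circ x.
Proof.
have hx := idem_op_inv addI x.
(* Adding the idempotent [x - x] is multiplying by it, and centrality moves it next to [x], which
   absorbs it. *)
rewrite -addA -addNC -(add_idemC _ hx) -(circ_idem _ hx) circA.
rewrite (circ_idemC a (add_idem_circ hx)) -circA -circV.
by rewrite (op_opVop circI).
Qed.

Lemma circ_addNl a b : a + (- a + a \circ b) = a \circ b.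
Proof.
have ha := idem_op_inv addI a.
by rewrite addA -(circ_idem _ ha) circA -circV (op_opVop circI).
Qed.

Lemma blambdaE a x : blambda a x = bdot a x + x.
Proof. by rewrite /blambda /bdot -2!addA (addA (a \circ x)) circ_addNr. Qed.

Lemma circ_bdot x a : x \circ a = x + bdot x a + a.
Proof. by rewrite -addA -blambdaE circ_addNl. Qed.

(** Distribute [x^-1 \circ (x - x)], which equals [x^-1]. This reduces closure under [binv] to
    closure under [blambda]. *)
Lemma binvE x : x^-1 = (x - x) + blambda x^-1 (- x).
Proof.
have := bcircDr x^-1 x (- x).
by rewrite -circVC -circV circA (op_Vop_opV circI) -addA.
Qed.

Lemma binv_circD a b :
  a^-1 \circ (b + a) = a^-1 + blambda a^-1 b - a^-1 + (a - a).
Proof. by rewrite bcircDr circ_addNl -circVC circV. Qed.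

Lemma circ_conj a b : b \circ a = a \circ (a^-1 \circ b \circ a).
Proof.
by rewrite !circA (circ_idemC _ (idem_op_inv circI a)) -!circA -circVC
  -(circ_idemC _ (idem_op_inv circI a)) (op_opVop circI).
Qed.

(** * The two implications of the criterion *)

Lemma bdot_set_sub (X Z I : set S) :
  inverse_subsemigroup (@badd S) (@bopp S) I ->
  (forall x z, X x -> Z z -> I (bdot x z)) -> bdot_set X Z `<=` I.
Proof.
by move=> hI h; apply: smallest_sub => // _ [x Xx [z Zz <-]]; apply: h.
Qed.

Lemma bdot_set_in (X Z : set S) x z : X x -> Z z -> bdot_set X Z (bdot x z).
Proof.
by move=> Xx Zz; apply: sub_gen_smallest; exists x => //; exists z.
Qed.

Lemma ideal_bdot_sub (I : set S) :
  ideal I -> bdot_set setT I `<=` I /\ bdot_set I setT `<=` I.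
Proof.
move=> [[_ [addIn oppIn] conjI] [_ _ conjcI] lamI].
split; apply: bdot_set_sub => // x z.
  by move=> _ Iz; apply: addIn; [apply: lamI | apply: oppIn].
(* With [y] the conjugate of [x] by [z] under [\circ], [x \circ z = z \circ y], so [bdot x z] is
   [- x] plus the additive conjugate [z + blambda z y - z]. *)
move=> Ix _; rewrite /bdot -addA circ_conj -circ_addNl.
apply: addIn; first exact: oppIn.
rewrite -{1}(semigroup_invK addI z).
by apply: conjI; apply: lamI; apply: conjcI.
Qed.

Lemma bdot_sub_ideal (I : set S) : normal_subsemigroup (@badd S) (@bopp S) I ->
  bdot_set setT I `<=` I -> bdot_set I setT `<=` I -> ideal I.
Proof.
move=> nI SI IS; have [idI [addIn oppIn] conjI] := nI.
have lamI a x : I x -> I (blambda a x).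
  move=> Ix; rewrite blambdaE; apply: addIn => //.
  by apply: SI; exact: bdot_set_in.
have subI x : I (x - x) by apply/idI/idem_op_inv.
split=> //; split.
- by move=> e he; apply/idI/circ_idem_add.
- split=> [x y Ix Iy|x Ix]; last first.
    by rewrite binvE; apply: addIn => //; apply/lamI/oppIn.
  (* Closure under [\circ] comes from [x \circ y = x + blambda x y]. *)
  by rewrite -circ_addNl; apply: addIn => //; apply: lamI.
- move=> a x Ix; rewrite -circA (circ_bdot x) binv_circD; apply: (addIn) => //.
  rewrite -{1}(semigroup_invK addI a^-1); apply: conjI; apply: lamI.
  by apply: addIn => //; apply: IS; exact: bdot_set_in.
Qed.

End DualWeakBrace.

Theorem corollary4p6 (S : dualWeakBrace) (I : set S)
    (hI : normal_subsemigroup (@badd S) (@bopp S) I) :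
  ideal I <-> bdot_set setT I `<=` I /\ bdot_set I setT `<=` I.
Proof.
by split; [exact: ideal_bdot_sub | case; exact: bdot_sub_ideal].
Qed.
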